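(* For $n\in\{1,2\}$ and every $x>0$, $$\sqrt[n]{\frac{\bigl\vert\psi^{(n)}(x)\bigr\vert}{(n-1)!}}\, > e^{-\psi(1/\ln(1+1/x))}.$$ Moreover, for every $n\in\mathbb{N}$, every integer $k$ with $1\le k\le n-1$, and every $x>0$, $$\sqrt[n]{\frac{\bigl\vert\psi^{(n)}(x)\bigr\vert}{(n-1)!}}\, > \sqrt[k]{\frac{\bigl\vert\psi^{(k)}\bigl(1/\ln(1+1/x)\bigr)\bigr\vert}{(k-1)!}}.$$
   Context: $\Gamma(x)=\int_0^\infty t^{x-1}e^{-t}\,dt$ for $x>0$ is Euler's gamma function, $\psi(x)=\Gamma'(x)/\Gamma(x)$ is the psi (digamma) function, and $\psi^{(i)}$ for $i\in\mathbb{N}$ denotes the $i$-th derivative of $\psi$ (polygamma functions). *)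

(* Defs.v *)
From Stdlib Require Import Reals.
From Coquelicot Require Import Coquelicot.
Open Scope R_scope.

Definition Gamma (x : R) : R :=
  RInt_gen (fun t => Rpower t (x - 1) * exp (- t)) (at_right 0) (Rbar_locally p_infty).

Definition psi (x : R) : R := Derive Gamma x / Gamma x.

Definition polygamma (n : nat) (x : R) : R := Derive_n psi n x.

Definition root_term (n : nat) (x : R) : R :=
  Rpower (Rabs (polygamma n x) / INR (Factorial.fact (n - 1))) (/ INR n).

(* Main.v *)
(* Write [u = 1 / ln (1 + 1/x)], so that [exp (1/u) - 1 = 1/x], and
   [zeta(m, x) = sum_j 1 / (x + j)^m], so that [|psi^(n)(x)| = n! zeta(n+1, x)].

   In the second claim [1/x] separates the two sides. The bound
   [n zeta(n+1, x) > 1/x^n] is a comparison with a telescoping series, and so is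
   [k zeta(k+1, y) <= (exp (1/y) - 1)^k], taken at [y = u]: with [s = 1/y],
   [A = e^s - 1] and [B = e^(s/(1+s)) - 1], one has [A - B >= s^2] and
   [(A + B)/2 >= s], whence [A^k - B^k >= k (A - B) ((A + B)/2)^(k-1) >= k s^(k+1)].

   For the first claim, [psi y >= ln y - 1/y] and [s e^(s/2) <= e^s - 1] at
   [s = 1/u] give [exp (- 2 psi u) <= s^2 e^(2s) <= (1/x)^2 (1 + 1/x)]; this is
   below [2 zeta(3, x)] and below the square of [1/x + 1/(2x^2) < zeta(2, x)] by the
   trapezoidal rule, that is, again by telescoping.

   The series for [psi] comes from Euler's product: [Gamma (n + x) ~ n^x Gamma n]
   follows by integrating the tangent line of [t^x] against [t^(n-1) e^(-t)]. *)
Require Import Defs.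
From Stdlib Require Import Reals Lra Lia.
From Coquelicot Require Import Coquelicot.
Open Scope R_scope.

(** * Elementary inequalities for the exponential and for powers *)

Lemma nondecreasing_of_derive (f df : R -> R) (a b : R) :
  a <= b ->
  (forall x, a <= x <= b -> is_derive f x (df x)) ->
  (forall x, a <= x <= b -> 0 <= df x) ->
  f a <= f b.
Proof.
  intros Hab Hd Hpos.
  destruct (MVT_gen f a b df) as [c [Hc He]].
  - intros x Hx. rewrite Rmin_left, Rmax_right in Hx by lra. apply Hd; lra.
  - intros x Hx. rewrite Rmin_left, Rmax_right in Hx by lra.
    apply derivable_continuous_pt. exists (df x). apply is_derive_Reals, Hd; lra.
  - rewrite Rmin_left, Rmax_right in Hc by lra.
    assert (0 <= df c * (b - a)) by (apply Rmult_le_pos; [apply Hpos|]; lra).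
    lra.
Qed.

(* The last Taylor coefficient [1/120] is enlarged to [1/96], which makes
   [exp (- w)] times the polynomial nondecreasing on [0, 1]. *)
Lemma exp_le_taylor5 (w : R) :
  0 <= w <= 1 ->
  exp w <= 1 + w + w ^ 2 / 2 + w ^ 3 / 6 + w ^ 4 / 24 + w ^ 5 / 96.
Proof.
  intros Hw.
  assert (H := nondecreasing_of_derive
    (fun w => exp (- w) * (1 + w + w ^ 2 / 2 + w ^ 3 / 6 + w ^ 4 / 24 + w ^ 5 / 96))
    (fun w => exp (- w) * (w ^ 4 * (1 - w) / 96)) 0 w).
  cbv beta in H.
  assert (H1 : 1 <= exp (- w) *
    (1 + w + w ^ 2 / 2 + w ^ 3 / 6 + w ^ 4 / 24 + w ^ 5 / 96)).
  { rewrite Ropp_0, exp_0 in H. eapply Rle_trans; [|apply H].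
    - lra.
    - lra.
    - intros x Hx. auto_derive; [easy|]. field.
    - intros x Hx. apply Rmult_le_pos; [left; apply exp_pos|].
      assert (0 <= x ^ 4) by (apply pow_le; lra). nra. }
  rewrite exp_Ropp in H1.
  assert (He := exp_pos w).
  apply (Rmult_le_compat_l (exp w)) in H1; [|lra].
  rewrite <- Rmult_assoc, Rinv_r in H1 by lra. lra.
Qed.

Lemma exp_ge_taylor5 (s : R) :
  0 <= s ->
  1 + s + s ^ 2 / 2 + s ^ 3 / 6 + s ^ 4 / 24 + s ^ 5 / 120 <= exp s.
Proof.
  intros Hs. assert (H := exp_ge_taylor s 5 Hs). simpl in H. lra.
Qed.

(** Since [e^s - e^(s/(1+s)) = s^2 + s^5/6 + ...], the bound is tight through order 4, so Taylor
    bounds of degree 5 are used. With [w = s/(1+s)] substituted, what is left over [(1+s)^5] has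
    only positive coefficients. *)
Lemma exp_sub_shift_ge (s : R) :
  0 < s -> s ^ 2 <= exp s - exp (s / (1 + s)).
Proof.
  intros Hs.
  assert (H1 := exp_ge_taylor5 s (Rlt_le _ _ Hs)).
  assert (Hw : 0 <= s / (1 + s) <= 1).
  { split; [apply Rdiv_le_0_compat; lra|].
    apply Rle_div_l; lra. }
  assert (H2 := exp_le_taylor5 _ Hw).
  set (w := s / (1 + s)) in *.
  assert (E : (1 + s + s ^ 2 / 2 + s ^ 3 / 6 + s ^ 4 / 24 + s ^ 5 / 120) - s ^ 2
     - (1 + w + w ^ 2 / 2 + w ^ 3 / 6 + w ^ 4 / 24 + w ^ 5 / 96)
     = s ^ 5 * (79 / 480 + 5 / 8 * s + 5 / 6 * s ^ 2 + 11 / 24 * s ^ 3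
                + 1 / 12 * s ^ 4 + 1 / 120 * s ^ 5) / (1 + s) ^ 5).
  { unfold w. field. lra. }
  assert (0 <= s ^ 5 * (79 / 480 + 5 / 8 * s + 5 / 6 * s ^ 2 + 11 / 24 * s ^ 3
                + 1 / 12 * s ^ 4 + 1 / 120 * s ^ 5) / (1 + s) ^ 5).
  { apply Rdiv_le_0_compat; [|apply pow_lt; lra].
    assert (forall n, 0 <= s ^ n) by (intros; apply pow_le; lra).
    apply Rmult_le_pos; [easy|].
    assert (A2 := H 2%nat); assert (A3 := H 3%nat); assert (A4 := H 4%nat);
    assert (A5 := H 5%nat). lra. }
  lra.
Qed.

(** Quadratic Taylor bounds for both exponentials suffice: they leave the surplus
    [s^4 / (2 (1+s)^2)]. *)
Lemma exp_add_shift_ge (s : R) :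
  0 < s -> 2 * s <= (exp s - 1) + (exp (s / (1 + s)) - 1).
Proof.
  intros Hs.
  assert (H1 := exp_ge_taylor s 2 (Rlt_le _ _ Hs)).
  assert (Hw : 0 <= s / (1 + s)) by (apply Rdiv_le_0_compat; lra).
  assert (H2 := exp_ge_taylor _ 2 Hw).
  simpl in H1, H2. set (w := s / (1 + s)) in *.
  assert (E : s + s ^ 2 / 2 + w + w ^ 2 / 2 - 2 * s = s ^ 4 / (2 * (1 + s) ^ 2)).
  { unfold w. field. lra. }
  assert (0 <= s ^ 4 / (2 * (1 + s) ^ 2)).
  { apply Rdiv_le_0_compat; [apply pow_le; lra|].
    assert (0 < (1 + s) ^ 2) by (apply pow_lt; lra). lra. }
  lra.
Qed.

(** Division by [e^(s/2)] turns this into [r <= sinh r] at [r = s/2]. The derivative [2 cosh r - 2]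
    is nonnegative by the AM-GM inequality, because [e^r e^(-r) = 1]. *)
Lemma mul_exp_half_le (s : R) : 0 <= s -> s * exp (s / 2) <= exp s - 1.
Proof.
  intros Hs.
  assert (H := nondecreasing_of_derive
    (fun r => exp r - exp (- r) - 2 * r)
    (fun r => exp r + exp (- r) - 2) 0 (s / 2)).
  cbv beta in H.
  assert (H1 : s <= exp (s / 2) - exp (- (s / 2))).
  { rewrite Ropp_0, exp_0 in H.
    assert (1 - 1 - 2 * 0 <= exp (s / 2) - exp (- (s / 2)) - 2 * (s / 2)); [|lra].
    apply H.
    - lra.
    - intros x Hx. auto_derive; [easy|]. ring.
    - intros x Hx.
      assert (E : exp x * exp (- x) = 1) by (rewrite <- exp_plus, Rplus_opp_r; apply exp_0).
      assert (Hp := exp_pos x). assert (Hq := exp_pos (- x)).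
      assert (0 <= (exp x - exp (- x)) ^ 2) by apply pow2_ge_0.
      nra. }
  apply (Rmult_le_compat_r (exp (s / 2))) in H1; [|left; apply exp_pos].
  rewrite Rmult_minus_distr_r, <- !exp_plus, Rplus_opp_l, exp_0 in H1.
  replace (s / 2 + s / 2) with s in H1 by field. exact H1.
Qed.

(* The two inequalities need each other in the induction. *)
Lemma pow_add_pow_sub_ge (m d : R) (k : nat) :
  0 <= d <= m ->
  2 * m ^ k <= (m + d) ^ k + (m - d) ^ k /\
  2 * INR k * d * m ^ (k - 1) <= (m + d) ^ k - (m - d) ^ k.
Proof.
  intros Hd. induction k as [|k [IH1 IH2]].
  - simpl. lra.
  - assert (Hk : m * (2 * INR k * d * m ^ (k - 1)) = 2 * INR k * d * m ^ k).
    { destruct k; [simpl; ring|].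
      replace (S k - 1)%nat with k by lia. simpl pow. ring. }
    assert (Hm : 0 <= m ^ k) by (apply pow_le; lra).
    replace (S k - 1)%nat with k by lia.
    rewrite S_INR. simpl pow.
    assert (Hp : (m - d) ^ k <= (m + d) ^ k) by (apply pow_incr; lra).
    split; [nra|].
    apply (Rmult_le_compat_l m) in IH2; [|lra].
    rewrite Hk in IH2.
    apply (Rmult_le_compat_l d) in IH1; [|lra].
    lra.
Qed.

(** The derivative of [t^k] is convex for [t >= 0], so its mean over [[B, A]] is at least its value
    at the midpoint. *)
Lemma pow_sub_ge_midpoint (A B : R) (k : nat) :
  0 <= B <= A ->
  INR k * (A - B) * ((A + B) / 2) ^ (k - 1) <= A ^ k - B ^ k.
Proof.
  intros H.
  destruct (pow_add_pow_sub_ge ((A + B) / 2) ((A - B) / 2) k) as [_ H2]; [lra|].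
  replace ((A + B) / 2 + (A - B) / 2) with A in H2 by field.
  replace ((A + B) / 2 - (A - B) / 2) with B in H2 by field.
  lra.
Qed.

(** The factor [a] keeps the exponent [n - 1] out of the mean value estimate
    [a^n - b^n <= n a^(n-1) (a - b)], which makes the induction direct. *)
Lemma pow_sub_le (a b : R) (n : nat) :
  0 <= b <= a -> a * (a ^ n - b ^ n) <= INR n * a ^ n * (a - b).
Proof.
  intros H. induction n as [|n IH]; [simpl; lra|].
  rewrite S_INR. simpl pow.
  assert (b ^ n <= a ^ n) by (apply pow_incr; lra).
  assert (0 <= b ^ n) by (apply pow_le; lra).
  apply (Rmult_le_compat_l a) in IH; [|lra].
  assert (a * (a - b) * b ^ n <= a * (a - b) * a ^ n)
    by (apply Rmult_le_compat_l; [apply Rmult_le_pos; lra|lra]).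
  nra.
Qed.

(** * Telescoping series and Hurwitz zeta values *)

Lemma is_series_telescope (g : nat -> R) (l : R) :
  is_lim_seq g l -> is_series (fun j => g j - g (S j)) (g 0%nat - l).
Proof.
  intros Hg. change (is_lim_seq (sum_n (fun j => g j - g (S j))) (g 0%nat - l)).
  apply is_lim_seq_ext with (fun n => g 0%nat - g (S n)).
  - induction n as [|n IH]; [now rewrite sum_O|].
    rewrite sum_Sn, <- IH. unfold plus; simpl. ring.
  - apply is_lim_seq_minus'; [apply is_lim_seq_const|].
    now apply -> is_lim_seq_incr_1.
Qed.

Lemma Series_le_telescope (a g : nat -> R) :
  is_lim_seq g 0 -> (forall j, 0 <= a j <= g j - g (S j)) -> Series a <= g 0%nat.
Proof.
  intros Hg Ha. assert (H := is_series_telescope g 0 Hg).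
  rewrite Rminus_0_r in H. rewrite <- (is_series_unique _ _ H).
  apply Series_le; [exact Ha|]. now exists (g 0%nat).
Qed.

(** Strictness is taken from the term of index 0; the tails are compared weakly. *)
Lemma Series_gt_telescope (a g : nat -> R) :
  is_lim_seq g 0 -> (forall j, 0 <= g j - g (S j) < a j) -> ex_series a ->
  g 0%nat < Series a.
Proof.
  intros Hg Ha Hex. assert (H := is_series_telescope g 0 Hg).
  rewrite Rminus_0_r in H. rewrite <- (is_series_unique _ _ H).
  rewrite (Series_incr_1 a) by easy.
  rewrite Series_incr_1 by now exists (g 0%nat).
  apply Rplus_lt_le_compat; [apply Ha|].
  apply Series_le; [intros j; split; [apply Ha|left; apply Ha]|].
  now apply -> (@ex_series_incr_1 R_AbsRing R_NormedModule).
Qed.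

Lemma Series_ge_telescope (a g : nat -> R) :
  is_lim_seq g 0 -> (forall j, g j - g (S j) <= a j) -> ex_series a -> g 0%nat <= Series a.
Proof.
  intros Hg Ha Hex. assert (H := is_series_telescope g 0 Hg).
  rewrite Rminus_0_r in H. apply Rminus_le_0.
  rewrite <- (is_series_unique _ _ H), <- Series_minus by (easy || now exists (g 0%nat)).
  (* Zero is written as a series, so that nonnegativity of the difference becomes a termwise
     comparison. *)
  replace 0 with (Series (fun _ : nat => 0 * 0)) by (rewrite Series_scal_l; ring).
  apply Series_le.
  - intros j. assert (Hj := Ha j). lra.
  - apply (ex_series_minus (V := R_NormedModule)); [easy|now exists (g 0%nat)].
Qed.

Definition hurwitz (m : nat) (x : R) : R := Series (fun j => / (x + INR j) ^ m).

Lemma add_INR_pos (x : R) (j : nat) : 0 < x -> 0 < x + INR j.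
Proof. intros; assert (H1 := pos_INR j); lra. Qed.

Lemma is_lim_seq_add_INR (x : R) : is_lim_seq (fun j => x + INR j) p_infty.
Proof.
  apply (is_lim_seq_plus (fun _ => x) INR x p_infty p_infty);
    [apply is_lim_seq_const|apply is_lim_seq_INR|easy].
Qed.

Lemma is_lim_seq_inv_add_INR (x : R) : is_lim_seq (fun j => / (x + INR j)) 0.
Proof.
  apply (is_lim_seq_inv _ p_infty); [apply is_lim_seq_add_INR|easy].
Qed.

Lemma is_lim_seq_pow_0 (u : nat -> R) (m : nat) :
  is_lim_seq u 0 -> is_lim_seq (fun j => u j ^ S m) 0.
Proof.
  intros Hu. induction m as [|m IH].
  - apply is_lim_seq_ext with u; [intros; simpl; ring|easy].
  - apply is_lim_seq_ext with (fun j => u j * u j ^ S m); [easy|].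
    replace 0 with (0 * 0) by ring. now apply is_lim_seq_mult'.
Qed.

(** For exponent 2, the shifted terms are dominated by the telescoping
    [1/y - 1/(y+1) = 1/(y (y+1))]. Each further factor [x + j] in the denominator is at least [x],
    which reduces higher exponents to 2. *)
Lemma ex_series_hurwitz (m : nat) (x : R) :
  (2 <= m)%nat -> 0 < x -> ex_series (fun j => / (x + INR j) ^ m).
Proof.
  intros Hm Hx. destruct m as [|[|m]]; [lia|lia|clear Hm].
  assert (H2 : ex_series (fun j => / (x + INR j) ^ 2)).
  { apply (@ex_series_incr_1 R_AbsRing R_NormedModule).
    apply (@ex_series_le R_AbsRing R_CompleteNormedModule) with
      (fun j => / (x + INR j) - / (x + INR (S j))).
    - intros j. change norm with Rabs.
      assert (Hj := add_INR_pos x j Hx). rewrite S_INR.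
      rewrite Rabs_pos_eq by (left; apply Rinv_0_lt_compat, pow_lt; lra).
      set (y := x + INR j) in *. replace (x + (INR j + 1)) with (y + 1) by (unfold y; ring).
      replace (/ y - / (y + 1)) with (/ (y * (y + 1))) by (field; lra).
      apply Rinv_le_contravar; nra.
    - eexists. apply (is_series_telescope (fun j => / (x + INR j)) 0), is_lim_seq_inv_add_INR. }
  apply (@ex_series_le R_AbsRing R_CompleteNormedModule) with
    (fun j => / x ^ m * / (x + INR j) ^ 2).
  - intros j. change norm with Rabs. assert (Hj := add_INR_pos x j Hx).
    rewrite Rabs_pos_eq by (left; apply Rinv_0_lt_compat, pow_lt; lra).
    assert (0 < x ^ m) by now apply pow_lt.
    assert (x ^ m <= (x + INR j) ^ m) by (apply pow_incr; assert (B := pos_INR j); lra).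
    assert (0 < (x + INR j) ^ 2) by (now apply pow_lt).
    rewrite <- Rinv_mult. apply Rinv_le_contravar.
    + now apply Rmult_lt_0_compat.
    + replace ((x + INR j) ^ S (S m)) with ((x + INR j) ^ m * (x + INR j) ^ 2) by (simpl; ring).
      apply Rmult_le_compat_r; lra.
  - now apply (ex_series_scal (V := R_NormedModule)).
Qed.

(** With [a = 1/y] and [b = 1/(y+1)] one has [a - b = a b], hence
    [a^n - b^n <= n a^n b < n a^(n+1)], and the left side telescopes. *)
Lemma hurwitz_gt_inv_pow (n : nat) (x : R) :
  (1 <= n)%nat -> 0 < x -> (/ x) ^ n < INR n * hurwitz (S n) x.
Proof.
  intros Hn Hx. unfold hurwitz. rewrite <- Series_scal_l.
  replace (/ x) with (/ (x + INR 0)) by (simpl; rewrite Rplus_0_r; easy).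
  apply (Series_gt_telescope _ (fun j => (/ (x + INR j)) ^ n)).
  - destruct n; [lia|]. apply is_lim_seq_pow_0, is_lim_seq_inv_add_INR.
  - intros j. assert (Hj := add_INR_pos x j Hx). rewrite S_INR.
    set (y := x + INR j) in *. replace (x + (INR j + 1)) with (y + 1) by (unfold y; ring).
    assert (Ha : 0 < / y) by (apply Rinv_0_lt_compat; lra).
    assert (Hb : 0 < / (y + 1)) by (apply Rinv_0_lt_compat; lra).
    assert (Hab : / (y + 1) < / y) by (apply Rinv_lt_contravar; nra).
    rewrite <- pow_inv.
    assert (E : / y - / (y + 1) = / y * / (y + 1)) by (field; lra).
    set (a := / y) in *. set (b := / (y + 1)) in *.
    assert (b ^ n <= a ^ n) by (apply pow_incr; lra).
    split; [lra|].
    assert (P := pow_sub_le a b n ltac:(lra)). rewrite E in P.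
    apply Rmult_lt_reg_l with a; [easy|].
    eapply Rle_lt_trans; [exact P|].
    assert (0 < a ^ n) by now apply pow_lt.
    assert (0 < INR n) by (apply lt_0_INR; lia).
    simpl pow.
    replace (INR n * a ^ n * (a * b)) with ((INR n * a ^ n * a) * b) by ring.
    replace (a * (INR n * (a * a ^ n))) with ((INR n * a ^ n * a) * a) by ring.
    apply Rmult_lt_compat_l; [|easy].
    apply Rmult_lt_0_compat; [|easy]. now apply Rmult_lt_0_compat.
  - apply (ex_series_scal (V := R_NormedModule)), ex_series_hurwitz; [lia|easy].
Qed.

Lemma exp_inv_shift_pow_ge (k : nat) (y : R) :
  (1 <= k)%nat -> 0 < y ->
  INR k * / y ^ S k <= (exp (/ y) - 1) ^ k - (exp (/ (y + 1)) - 1) ^ k.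
Proof.
  intros Hk Hy. rewrite <- pow_inv.
  assert (Hs : 0 < / y) by now apply Rinv_0_lt_compat.
  (* In the variable [s = 1/y], the shift from [y] to [y + 1] is the map from [s] to [s/(1+s)]. *)
  replace (/ (y + 1)) with (/ y / (1 + / y)) by (field; lra).
  set (s := / y) in *.
  assert (H1 := exp_sub_shift_ge s Hs). assert (H2 := exp_add_shift_ge s Hs).
  assert (Hw : 0 <= s / (1 + s)) by (apply Rdiv_le_0_compat; lra).
  assert (H3 := exp_ineq1_le (s / (1 + s))).
  set (A := exp s - 1) in *. set (B := exp (s / (1 + s)) - 1) in *.
  assert (HB : 0 <= B) by (unfold B; lra).
  assert (HAB : s ^ 2 <= A - B) by (unfold A, B; lra).
  assert (Hs2 : 0 <= s ^ 2) by apply pow2_ge_0.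
  eapply Rle_trans; [|apply pow_sub_ge_midpoint; lra].
  replace (s ^ S k) with (s ^ 2 * s ^ (k - 1))
    by (rewrite <- pow_add; f_equal; lia).
  rewrite Rmult_assoc. apply Rmult_le_compat_l; [apply pos_INR|].
  apply Rmult_le_compat; try easy.
  - apply pow_le; lra.
  - apply pow_incr; lra.
Qed.

Lemma hurwitz_le_exp_inv (k : nat) (y : R) :
  (1 <= k)%nat -> 0 < y -> INR k * hurwitz (S k) y <= (exp (/ y) - 1) ^ k.
Proof.
  intros Hk Hy. unfold hurwitz. rewrite <- Series_scal_l.
  replace (/ y) with (/ (y + INR 0)) by (simpl; rewrite Rplus_0_r; easy).
  apply (Series_le_telescope _ (fun j => (exp (/ (y + INR j)) - 1) ^ k)).
  - destruct k; [lia|]. apply is_lim_seq_pow_0.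
    replace 0 with (exp 0 - 1) by (rewrite exp_0; ring).
    apply is_lim_seq_minus'; [|apply is_lim_seq_const].
    apply is_lim_seq_continuous; [|apply is_lim_seq_inv_add_INR].
    apply derivable_continuous_pt, derivable_pt_exp.
  - intros j. assert (Hj := add_INR_pos y j Hy). split.
    + apply Rmult_le_pos; [apply pos_INR|].
      left; apply Rinv_0_lt_compat, pow_lt; easy.
    + rewrite S_INR, <- Rplus_assoc. now apply exp_inv_shift_pow_ge.
Qed.

(** The defect of each telescoping step is the error of the trapezoidal rule for [1/t^2] on
    [[y, y+1]], which equals [1 / (2 y^2 (y+1)^2)]. *)
Lemma hurwitz2_gt (x : R) : 0 < x -> / x + / (2 * x ^ 2) < hurwitz 2 x.
Proof.
  intros Hx. unfold hurwitz.
  replace (/ x + / (2 * x ^ 2)) with (/ (x + INR 0) + (/ (x + INR 0)) ^ 2 / 2)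
    by (simpl; rewrite Rplus_0_r; field; lra).
  apply (Series_gt_telescope _ (fun j => / (x + INR j) + (/ (x + INR j)) ^ 2 / 2)).
  - replace 0 with (0 + 0 * / 2) by ring.
    apply is_lim_seq_plus'; [apply is_lim_seq_inv_add_INR|].
    apply is_lim_seq_mult'; [|apply is_lim_seq_const].
    apply is_lim_seq_pow_0, is_lim_seq_inv_add_INR.
  - intros j. assert (Hj := add_INR_pos x j Hx). rewrite S_INR, <- Rplus_assoc.
    set (y := x + INR j) in *.
    assert (0 < y * y) by nra. assert (0 < y * (y + 1)) by nra.
    assert (0 < y ^ 2 * (y + 1) ^ 2) by (apply Rmult_lt_0_compat; apply pow_lt; lra).
    split.
    + replace (/ y + (/ y) ^ 2 / 2 - (/ (y + 1) + (/ (y + 1)) ^ 2 / 2))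
        with ((2 * y * y + 4 * y + 1) / (2 * (y ^ 2 * (y + 1) ^ 2))) by (field; lra).
      apply Rdiv_le_0_compat; nra.
    + apply Rminus_lt_0.
      replace (/ y ^ 2 - (/ y + (/ y) ^ 2 / 2 - (/ (y + 1) + (/ (y + 1)) ^ 2 / 2)))
        with (/ (2 * (y ^ 2 * (y + 1) ^ 2))) by (field; lra).
      apply Rinv_0_lt_compat; lra.
  - now apply ex_series_hurwitz.
Qed.

(** The same argument for [2/t^3]: the trapezoidal error on [[y, y+1]] is
    [(2y + 1) / (y^3 (y+1)^3)]. *)
Lemma hurwitz3_gt (x : R) : 0 < x -> (x + 1) / x ^ 3 < 2 * hurwitz 3 x.
Proof.
  intros Hx. unfold hurwitz. rewrite <- Series_scal_l.
  replace ((x + 1) / x ^ 3) with ((/ (x + INR 0)) ^ 2 + (/ (x + INR 0)) ^ 3)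
    by (simpl; rewrite Rplus_0_r; field; lra).
  apply (Series_gt_telescope _ (fun j => (/ (x + INR j)) ^ 2 + (/ (x + INR j)) ^ 3)).
  - replace 0 with (0 + 0) by ring.
    apply is_lim_seq_plus'; apply is_lim_seq_pow_0, is_lim_seq_inv_add_INR.
  - intros j. assert (Hj := add_INR_pos x j Hx). rewrite S_INR, <- Rplus_assoc.
    set (y := x + INR j) in *.
    assert (0 < y ^ 3 * (y + 1) ^ 3) by (apply Rmult_lt_0_compat; apply pow_lt; lra).
    split.
    + assert (/ (y + 1) <= / y) by (apply Rinv_le_contravar; lra).
      assert (0 < / (y + 1)) by (apply Rinv_0_lt_compat; lra).
      assert ((/ (y + 1)) ^ 2 <= (/ y) ^ 2) by (apply pow_incr; lra).
      assert ((/ (y + 1)) ^ 3 <= (/ y) ^ 3) by (apply pow_incr; lra).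
      lra.
    + apply Rminus_lt_0.
      replace (2 * / y ^ 3 - ((/ y) ^ 2 + (/ y) ^ 3 - ((/ (y + 1)) ^ 2 + (/ (y + 1)) ^ 3)))
        with ((2 * y + 1) / (y ^ 3 * (y + 1) ^ 3)) by (field; lra).
      apply Rdiv_lt_0_compat; lra.
  - apply (ex_series_scal (V := R_NormedModule)), ex_series_hurwitz; [lia|easy].
Qed.

(** * Integrals over (0, oo) and the Gamma function *)

Lemma locally_pos (x : R) : 0 < x -> locally x (fun y => 0 < y).
Proof. intros Hx. exact (open_gt 0 x Hx). Qed.

Notation is_int0oo f l := (is_RInt_gen f (at_right 0) (Rbar_locally p_infty) l).

(** Reduces eventual statements about the two limits of integration to explicit thresholds. Taking
    both thresholds equal to 1 ensures [a < b]. *)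
Lemma filter_prod_0oo (P : R -> R -> Prop) (a0 b0 : R) :
  0 < a0 ->
  (forall a b, 0 < a < a0 -> b0 < b -> P a b) ->
  filter_prod (at_right 0) (Rbar_locally p_infty) (fun ab => P (fst ab) (snd ab)).
Proof.
  intros Ha0 HP.
  apply Filter_prod with (fun a => 0 < a < a0) (fun b => b0 < b).
  - exists (mkposreal _ Ha0). intros y Hy H0. split; [easy|].
    unfold ball in Hy; simpl in Hy; unfold AbsRing_ball, abs, minus, plus, opp in Hy; simpl in Hy.
    apply Rabs_def2 in Hy. lra.
  - now exists b0.
  - exact HP.
Qed.

Lemma is_int0oo_ext (f g : R -> R) (l : R) :
  (forall t, 0 < t -> f t = g t) -> is_int0oo f l -> is_int0oo g l.
Proof.
  intros He. apply is_RInt_gen_ext.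
  apply (filter_prod_0oo (fun a b => forall x, Rmin a b < x < Rmax a b -> f x = g x) 1 1);
    [lra|].
  intros a b Ha Hb x Hx. rewrite Rmin_left in Hx by lra. apply He; lra.
Qed.

(** A nonnegative [f] dominates its own norm, so the norm bound for integrals gives [|l| <= l]. *)
Lemma is_int0oo_ge_0 (f : R -> R) (l : R) :
  (forall t, 0 < t -> 0 <= f t) -> is_int0oo f l -> 0 <= l.
Proof.
  intros Hf Hl.
  apply Rle_trans with (norm l); [apply Rabs_pos|].
  apply (@RInt_gen_norm R_CompleteNormedModule (at_right 0) (Rbar_locally p_infty) _ _ f f).
  - apply (filter_prod_0oo (fun a b => a <= b) 1 1); [lra|]. intros; lra.
  - apply (filter_prod_0oo (fun a b => forall x, a <= x <= b -> norm (f x) <= f x) 1 1); [lra|].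
    intros a b Ha Hb x Hx. change (Rabs (f x) <= f x).
    rewrite Rabs_pos_eq; [lra|apply Hf; lra].
  - exact Hl.
  - exact Hl.
Qed.

Lemma is_int0oo_le (f g : R -> R) (lf lg : R) :
  (forall t, 0 < t -> f t <= g t) ->
  is_int0oo f lf -> is_int0oo g lg -> lf <= lg.
Proof.
  intros Hfg Hf Hg. apply Rminus_le_0.
  apply (is_int0oo_ge_0 (fun t => g t - f t)).
  - intros t Ht. assert (H := Hfg t Ht). lra.
  - exact (is_RInt_gen_minus _ _ _ _ Hg Hf).
Qed.

Lemma is_int0oo_lin (f g : R -> R) (a b lf lg : R) :
  is_int0oo f lf -> is_int0oo g lg ->
  is_int0oo (fun t => a * f t + b * g t) (a * lf + b * lg).
Proof.
  intros Hf Hg.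
  exact (is_RInt_gen_plus _ _ _ _ (is_RInt_gen_scal _ a _ Hf) (is_RInt_gen_scal _ b _ Hg)).
Qed.

Lemma is_int0oo_derive (F f : R -> R) (la lb : R) :
  (forall t, 0 < t -> is_derive F t (f t)) ->
  (forall t, 0 < t -> continuous f t) ->
  filterlim F (at_right 0) (locally la) ->
  filterlim F (Rbar_locally p_infty) (locally lb) ->
  is_int0oo f (lb - la).
Proof.
  intros HF Hc Ha Hb.
  apply is_int0oo_ext with (Derive F).
  { intros t Ht. now apply is_derive_unique, HF. }
  apply is_RInt_gen_Derive; [| |exact Ha|exact Hb].
  - apply (filter_prod_0oo (fun a b => forall x, Rmin a b <= x <= Rmax a b -> ex_derive F x) 1 1);
      [lra|].
    intros a b Ha' Hb' x Hx. rewrite Rmin_left in Hx by lra. eexists; apply HF; lra.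
  - apply (filter_prod_0oo (fun a b => forall x, Rmin a b <= x <= Rmax a b -> continuous (Derive F) x) 1 1);
      [lra|].
    intros a b Ha' Hb' x Hx. rewrite Rmin_left in Hx by lra.
    assert (Hx0 : 0 < x) by lra.
    apply continuous_ext_loc with f; [|now apply Hc].
    apply (filter_imp (fun y => 0 < y)); [|now apply locally_pos].
    intros y Hy. symmetry. now apply is_derive_unique, HF.
Qed.

Lemma ex_RInt_pos (f : R -> R) (a b : R) :
  (forall t, 0 < t -> continuous f t) -> 0 < a -> 0 < b -> ex_RInt f a b.
Proof.
  intros Hc Ha Hb. apply (ex_RInt_continuous (V := R_CompleteNormedModule)). intros z Hz. apply Hc.
  unfold Rmin in Hz. destruct (Rle_dec a b); lra.
Qed.

Lemma RInt_pos_mono (f : R -> R) (a0 a b b0 : R) :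
  (forall t, 0 < t -> continuous f t) -> (forall t, 0 < t -> 0 <= f t) ->
  0 < a0 <= a -> a <= b -> b <= b0 -> RInt f a b <= RInt f a0 b0.
Proof.
  intros Hc Hf Ha Hab Hb.
  rewrite <- (RInt_Chasles f a0 a b0) by (apply ex_RInt_pos; [easy|lra|lra]).
  rewrite <- (RInt_Chasles f a b b0) by (apply ex_RInt_pos; [easy|lra|lra]).
  assert (0 <= RInt f a0 a).
  { apply RInt_ge_0; [lra|apply ex_RInt_pos; [easy|lra|lra]|]. intros; apply Hf; lra. }
  assert (0 <= RInt f b b0).
  { apply RInt_ge_0; [lra|apply ex_RInt_pos; [easy|lra|lra]|]. intros; apply Hf; lra. }
  unfold plus; simpl. lra.
Qed.

(** The value is the supremum of the integrals over compact subintervals. These grow with the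
    interval because [f] is nonnegative, so any subinterval that comes within [eps] of the supremum
    controls all larger ones. *)
Lemma ex_int0oo_bounded (f : R -> R) (M : R) :
  (forall t, 0 < t -> continuous f t) ->
  (forall t, 0 < t -> 0 <= f t) ->
  (forall a b, 0 < a <= b -> RInt f a b <= M) ->
  exists l, is_int0oo f l.
Proof.
  intros Hc Hf HM.
  destruct (completeness (fun r => exists a b, 0 < a <= b /\ r = RInt f a b)) as [l [Hub Hlub]].
  - exists M. intros r [a [b [Hab ->]]]. now apply HM.
  - exists (RInt f 1 1), 1, 1. split; [lra|easy].
  - exists l. apply (filterlimi_locally (F := filter_prod (at_right 0) (Rbar_locally p_infty))).
    intros eps.
    assert (Hex : exists a b, 0 < a <= b /\ l - eps < RInt f a b).
    { apply Classical_Prop.NNPP. intros Hn.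
      assert (l <= l - eps).
      { apply Hlub. intros r [a [b [Hab ->]]].
        apply Rnot_lt_le. intros Hlt. apply Hn. exists a, b. easy. }
      assert (He := cond_pos eps). lra. }
    destruct Hex as [a0 [b0 [Hab0 He]]].
    apply (filter_prod_0oo (fun a b => exists z, is_RInt f a b z /\ ball l eps z) a0 b0); [lra|].
    intros a b Ha Hb. exists (RInt f a b). split.
    + apply (RInt_correct (V := R_CompleteNormedModule)), ex_RInt_pos; [easy|lra|lra].
    + assert (H1 : RInt f a0 b0 <= RInt f a b) by (apply RInt_pos_mono; [easy|easy|lra|lra|lra]).
      assert (H2 : RInt f a b <= l) by (apply Hub; exists a, b; split; [lra|easy]).
      change (Rabs (RInt f a b - l) < eps). assert (Hp := cond_pos eps).
      apply Rabs_def1; lra.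
Qed.

(** * Convergence of the Gamma integral and its functional equation *)

Definition gamma_integrand (x t : R) : R := Rpower t (x - 1) * exp (- t).

Lemma is_derive_Rpower_exp (x t : R) :
  0 < t ->
  is_derive (fun t => Rpower t x * exp (- t)) t
    (x * gamma_integrand x t - gamma_integrand (x + 1) t).
Proof.
  intros Ht. unfold gamma_integrand.
  replace (x + 1 - 1) with x by ring.
  replace (Rpower t (x - 1)) with (Rpower t x / t).
  - unfold Rpower. auto_derive; [easy|]. field. lra.
  - unfold Rminus. rewrite Rpower_plus, Rpower_Ropp, Rpower_1 by easy. easy.
Qed.

Lemma continuous_gamma_integrand (x t : R) :
  0 < t -> continuous (gamma_integrand x) t.
Proof.
  intros Ht. apply (ex_derive_continuous (V := R_NormedModule)).
  unfold gamma_integrand, Rpower. auto_derive. easy.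
Qed.

Lemma gamma_integrand_pos (x t : R) : 0 < gamma_integrand x t.
Proof. apply Rmult_lt_0_compat; apply exp_pos. Qed.

Lemma filterlim_Rpower_exp_0 (x : R) :
  0 < x -> filterlim (fun t => Rpower t x * exp (- t)) (at_right 0) (locally 0).
Proof.
  intros Hx.
  replace 0 with (0 * exp (- 0)) at 2 by (rewrite Ropp_0, exp_0; ring).
  apply (filterlim_comp_2 (G := locally 0) (H := locally (exp (- 0)))).
  - unfold Rpower.
    apply (filterlim_comp _ _ _ (fun t => x * ln t) exp _ (Rbar_locally m_infty));
      [|apply is_lim_exp_m].
    apply (filterlim_comp _ _ _ ln (fun y => x * y) _ (Rbar_locally m_infty));
      [apply is_lim_ln_0|].
    intros P [N HN]. exists (N / x). intros y Hy. apply HN.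
    apply Rlt_div_r in Hy; [|lra]. lra.
  - apply (filterlim_filter_le_1 _ (filter_le_within (F := locally 0) _)).
    apply (ex_derive_continuous (V := R_NormedModule) (fun t => exp (- t))). auto_derive. easy.
  - apply (filterlim_mult 0 (exp (- 0))).
Qed.

Lemma exp_le_mono (a b : R) : a <= b -> exp a <= exp b.
Proof. intros [H| ->]; [left; now apply exp_increasing|apply Rle_refl]. Qed.

(** This is [ln r <= r - 1] at [r = t/(2x)], where [2x] is chosen so that the power costs only half
    of the exponential decay. *)
Lemma Rpower_exp_le (x t : R) :
  0 < x -> 0 < t -> Rpower t x * exp (- t) <= Rpower (2 * x) x * exp (- (t / 2)).
Proof.
  intros Hx Ht. unfold Rpower. rewrite <- !exp_plus.
  apply exp_le_mono.
  assert (H : ln (t / (2 * x)) <= t / (2 * x) - 1).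
  { assert (0 < t / (2 * x)) by (apply Rdiv_lt_0_compat; lra).
    assert (H1 := exp_ineq1_le (ln (t / (2 * x)))). rewrite exp_ln in H1 by easy. lra. }
  rewrite ln_div in H by lra.
  apply (Rmult_le_compat_l x) in H; [|lra].
  replace (x * (t / (2 * x) - 1)) with (t / 2 - x) in H by (field; lra). lra.
Qed.

Lemma filterlim_Rpower_exp_oo (x : R) :
  0 < x -> filterlim (fun t => Rpower t x * exp (- t)) (Rbar_locally p_infty) (locally 0).
Proof.
  intros Hx.
  apply (is_lim_le_le_loc (fun _ => 0) (fun t => Rpower (2 * x) x * exp (- (t / 2))) _ p_infty 0).
  - exists 0. intros t Ht. split.
    + left; apply Rmult_lt_0_compat; apply exp_pos.
    + now apply Rpower_exp_le.
  - apply is_lim_const.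
  - replace (Finite 0) with (Rbar_mult (Rpower (2 * x) x) 0) by (simpl; f_equal; ring).
    apply is_lim_scal_l.
    apply (filterlim_comp _ _ _ (fun t => - (t / 2)) exp _ (Rbar_locally m_infty));
      [|apply is_lim_exp_m].
    intros P [N HN]. exists (- 2 * N). intros y Hy. apply HN. lra.
Qed.

(** Integration by parts: [t^x e^(-t)] vanishes at both ends, so its derivative integrates to 0.
    Stated for [is_int0oo], the step carries convergence as well as the value from [x] to
    [x + 1]. *)
Lemma is_int_gamma_succ (x l : R) :
  0 < x -> is_int0oo (gamma_integrand x) l -> is_int0oo (gamma_integrand (x + 1)) (x * l).
Proof.
  intros Hx Hl.
  assert (H := is_int0oo_derive (fun t => Rpower t x * exp (- t))
    (fun t => x * gamma_integrand x t - gamma_integrand (x + 1) t) 0 0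
    (is_derive_Rpower_exp x)).
  assert (H1 : is_int0oo (fun t => x * gamma_integrand x t - gamma_integrand (x + 1) t) (0 - 0)).
  { apply H.
    - intros t Ht.
      apply (continuous_minus (V := R_NormedModule)); [|now apply continuous_gamma_integrand].
      apply (continuous_scal_r (V := R_NormedModule)). now apply continuous_gamma_integrand.
    - now apply filterlim_Rpower_exp_0.
    - now apply filterlim_Rpower_exp_oo. }
  assert (H2 := is_RInt_gen_scal _ x _ Hl).
  assert (H3 := is_RInt_gen_minus _ _ _ _ H2 H1).
  replace (x * l) with (minus (scal x l) (0 - 0)).
  - apply is_int0oo_ext with (2 := H3). intros t _.
    unfold minus, scal, plus, opp; simpl. unfold mult; simpl. ring.
  - unfold minus, scal, plus, opp; simpl. unfold mult; simpl. ring.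
Qed.

Lemma is_int_gamma_1 : is_int0oo (gamma_integrand 1) 1.
Proof.
  replace 1 with (0 - - exp (- 0)) at 2 by (rewrite Ropp_0, exp_0; ring).
  apply (is_int0oo_derive (fun t => - exp (- t))).
  - intros t Ht. unfold gamma_integrand. rewrite Rminus_diag, Rpower_O by easy.
    auto_derive; [easy|]. ring.
  - intros; now apply continuous_gamma_integrand.
  - apply (filterlim_filter_le_1 _ (filter_le_within (F := locally 0) _)).
    apply (ex_derive_continuous (V := R_NormedModule) (fun t => - exp (- t))). auto_derive. easy.
  - replace (locally 0) with (locally (- 0)) by now rewrite Ropp_0.
    apply (filterlim_comp _ _ _ (fun t => exp (- t)) Ropp _ (locally 0)).
    + apply (filterlim_comp _ _ _ Ropp exp _ (Rbar_locally m_infty)).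
      * intros P [N HN]. exists (- N). intros y Hy. apply HN. lra.
      * apply is_lim_exp_m.
    + apply (filterlim_opp 0).
Qed.

Lemma Rpower_le_1_add (x t : R) : 0 < x <= 1 -> 0 < t -> Rpower t x <= 1 + t.
Proof.
  intros Hx Ht. destruct (Rle_dec 1 t).
  - rewrite <- (Rpower_1 t) at 2 by easy.
    assert (Rpower t x <= Rpower t 1) by (apply Rle_Rpower; lra). lra.
  - assert (H : Rpower t x <= Rpower 1 x) by (apply Rle_Rpower_l; lra).
    unfold Rpower at 2 in H. rewrite ln_1, Rmult_0_r, exp_0 in H. lra.
Qed.

(* One integration by parts, [t^(x-1) e^(-t) = (t^x e^(-t))' / x + t^x e^(-t) / x],
   removes the singularity at 0; then [t^x <= 1 + t]. *)
Lemma RInt_gamma_le (x a b : R) :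
  0 < x <= 1 -> 0 < a <= b -> RInt (gamma_integrand x) a b <= 3 / x.
Proof.
  intros Hx Hab.
  (* [- (2 + t) e^(-t)] is an antiderivative of [(1 + t) e^(-t)], which dominates
     [gamma_integrand (x + 1)]. So [K] is an antiderivative of [k], and [k] dominates
     [gamma_integrand x]. *)
  set (K := fun t => (Rpower t x * exp (- t) - (2 + t) * exp (- t)) / x).
  set (k := fun t => ((x * gamma_integrand x t - gamma_integrand (x + 1) t)
                        + (1 + t) * exp (- t)) / x).
  assert (HK : is_RInt k a b (K b - K a)).
  { apply (is_RInt_derive (V := R_CompleteNormedModule) K).
    - intros t Ht. rewrite Rmin_left in Ht by lra. unfold K, k.
      assert (Ht0 : 0 < t) by lra. assert (H := is_derive_Rpower_exp x t Ht0).
      apply (is_derive_ext (fun t => / x * (Rpower t x * exp (- t)) - / x * ((2 + t) * exp (- t))));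
        [intros; match goal with |- ?u = ?v => change (@eq R u v) end; field; lra|].
      replace ((x * gamma_integrand x t - gamma_integrand (x + 1) t + (1 + t) * exp (- t)) / x)
        with (/ x * (x * gamma_integrand x t - gamma_integrand (x + 1) t)
              - / x * (- ((1 + t) * exp (- t)))) by (unfold Rdiv; ring).
      apply (is_derive_minus (V := R_NormedModule)).
      + now apply is_derive_scal.
      + apply is_derive_scal. auto_derive; [easy|]. ring.
    - intros t Ht. rewrite Rmin_left in Ht by lra. unfold k.
      apply (continuous_mult (K := R_AbsRing)); [|apply continuous_const].
      apply (continuous_plus (V := R_NormedModule)).
      + apply (continuous_minus (V := R_NormedModule)); [|apply continuous_gamma_integrand; lra].
        apply (continuous_scal_r (V := R_NormedModule)). apply continuous_gamma_integrand; lra.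
      + apply (ex_derive_continuous (V := R_NormedModule)). auto_derive. easy. }
  apply Rle_trans with (K b - K a).
  - rewrite <- (is_RInt_unique _ _ _ _ HK).
    apply RInt_le; [lra| | |].
    + apply ex_RInt_pos; [intros; now apply continuous_gamma_integrand|lra|lra].
    + now exists (K b - K a).
    + intros t Ht. unfold k.
      assert (H1 := Rpower_le_1_add x t Hx ltac:(lra)).
      assert (H2 := exp_pos (- t)).
      assert (gamma_integrand (x + 1) t <= (1 + t) * exp (- t)).
      { unfold gamma_integrand. replace (x + 1 - 1) with x by ring. nra. }
      apply (Rle_div_r (gamma_integrand x t)); lra.
  (* The upper bound is [t^x <= 1 + t]. The lower one follows from [(1 + t) e^(-t) <= 1] and
     [e^(-t) <= 1]. The increment of [K] is therefore at most [2/x]. *)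
  - assert (HB : forall t, 0 < t -> - 2 / x <= K t <= 0).
    { intros t Ht. unfold K. assert (H1 := Rpower_le_1_add x t Hx Ht).
      assert (H2 := exp_pos (- t)). assert (H3 : 0 < Rpower t x) by apply exp_pos.
      assert (H4 := exp_ineq1_le t). rewrite exp_Ropp in H2 |- *.
      assert (H0 := exp_pos t).
      assert (H5 : exp t * / exp t = 1) by (apply Rinv_r; lra).
      assert (H6 := Rmult_le_compat_r (/ exp t) _ _ (Rlt_le _ _ H2) H4). rewrite H5 in H6.
      assert (H7 := Rmult_le_compat_r (/ exp t) _ _ (Rlt_le _ _ H2) H1).
      assert (H8 := Rmult_lt_0_compat _ _ H3 H2).
      assert (H9 := Rmult_lt_0_compat _ _ Ht H2).
      split.
      - apply Rmult_le_compat_r; [left; apply Rinv_0_lt_compat; lra|]. lra.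
      - apply Rle_div_l; lra. }
    assert (H1 := HB a ltac:(lra)). assert (H2 := HB b ltac:(lra)).
    assert (0 < / x) by (apply Rinv_0_lt_compat; lra). unfold Rdiv in *. lra.
Qed.

Lemma Gamma_unique (x l : R) : is_int0oo (gamma_integrand x) l -> Gamma x = l.
Proof.
  intros H. unfold Gamma. apply (is_RInt_gen_unique (V := R_CompleteNormedModule)). exact H.
Qed.

(** Induction along the functional equation: a property is proved on [(0, 1]] and then moved by unit
    steps. *)
Lemma pos_real_ind (P : R -> Prop) :
  (forall x, 0 < x <= 1 -> P x) ->
  (forall x, 0 < x -> P x -> P (x + 1)) ->
  forall x, 0 < x -> P x.
Proof.
  intros H1 HS x Hx. destruct (nfloor_ex x) as [n Hn]; [lra|].
  assert (Hnx : x <= INR n + 1) by lra. clear Hn.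
  revert x Hx Hnx. induction n as [|n IH]; intros x Hx Hn.
  - simpl in Hn. apply H1; lra.
  - destruct (Rle_dec x 1); [apply H1; lra|].
    rewrite S_INR in Hn. replace x with (x - 1 + 1) by ring.
    apply HS; [lra|]. apply IH; lra.
Qed.

(** [Gamma] is given by a total integral operator, so convergence has to be shown first: by bounded
    partial integrals on [(0, 1]], and by the functional equation beyond. *)
Lemma is_int_gamma (x : R) : 0 < x -> is_int0oo (gamma_integrand x) (Gamma x).
Proof.
  intros Hx.
  assert (Hex : exists l, is_int0oo (gamma_integrand x) l).
  { revert x Hx. apply pos_real_ind.
    - intros x Hx. apply ex_int0oo_bounded with (3 / x).
      + intros; now apply continuous_gamma_integrand.
      + intros; left; apply gamma_integrand_pos.
      + intros a b Hab. now apply RInt_gamma_le.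
    - intros x Hx [l Hl]. exists (x * l). now apply is_int_gamma_succ. }
  destruct Hex as [l Hl].
  replace (Gamma x) with l; [easy|].
  symmetry. now apply Gamma_unique.
Qed.

Lemma Gamma_1 : Gamma 1 = 1.
Proof. apply Gamma_unique, is_int_gamma_1. Qed.

Lemma Gamma_succ (x : R) : 0 < x -> Gamma (x + 1) = x * Gamma x.
Proof.
  intros Hx. apply Gamma_unique, is_int_gamma_succ; [easy|]. now apply is_int_gamma.
Qed.

(** * Euler's product and the series for psi *)

Lemma ln_le_sub_1 (r : R) : 0 < r -> ln r <= r - 1.
Proof.
  intros Hr. assert (H := exp_ineq1_le (ln r)). rewrite exp_ln in H by easy. lra.
Qed.

Lemma ln_sub_le (u v : R) : 0 < u -> 0 < v -> ln u - ln v <= (u - v) / v.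
Proof.
  intros Hu Hv. rewrite <- ln_div by easy.
  replace ((u - v) / v) with (u / v - 1) by (field; lra).
  apply ln_le_sub_1. now apply Rdiv_lt_0_compat.
Qed.

(** Weighted AM-GM for [r] and 1 with weights [x] and [1 - x]. Their weighted mean is [y], so the
    first-order terms of the tangent to [ln] at [y] cancel. *)
Lemma Rpower_le_tangent (r x : R) :
  0 <= x <= 1 -> 0 < r -> Rpower r x <= 1 + x * (r - 1).
Proof.
  intros Hx Hr. set (y := 1 + x * (r - 1)).
  assert (Hy : 0 < y).
  { unfold y. destruct (Req_dec x 1) as [->|]; nra. }
  rewrite <- (exp_ln y Hy). unfold Rpower. apply exp_le_mono.
  assert (H1 := ln_sub_le r y Hr Hy). assert (H2 := ln_sub_le 1 y Rlt_0_1 Hy).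
  rewrite ln_1 in H2.
  apply (Rmult_le_compat_l x) in H1; [|lra].
  apply (Rmult_le_compat_l (1 - x)) in H2; [|lra].
  assert (E : x * ((r - y) / y) + (1 - x) * ((1 - y) / y) = 0).
  { replace (x * ((r - y) / y) + (1 - x) * ((1 - y) / y))
      with ((1 + x * (r - 1) - y) / y) by (field; lra).
    unfold y. field. fold y. lra. }
  lra.
Qed.

Lemma Rpower_ge_tangent (r p : R) :
  p <= 0 -> 0 < r -> 1 + p * (r - 1) <= Rpower r p.
Proof.
  intros Hp Hr. unfold Rpower.
  apply Rle_trans with (1 + p * ln r); [|apply exp_ineq1_le].
  assert (H := ln_le_sub_1 r Hr). nra.
Qed.

Lemma gamma_integrand_add (y p m t : R) :
  0 < m -> 0 < t ->
  gamma_integrand (y + p) t = Rpower m p * (Rpower (t / m) p * gamma_integrand y t).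
Proof.
  intros Hm Ht. unfold gamma_integrand.
  rewrite <- Rmult_assoc, Rpower_mult_distr by (try apply Rdiv_lt_0_compat; easy).
  replace (m * (t / m)) with t by (field; lra).
  rewrite <- Rmult_assoc, <- Rpower_plus. f_equal. f_equal. ring.
Qed.

Lemma gamma_integrand_succ (y t : R) :
  0 < t -> gamma_integrand (y + 1) t = t * gamma_integrand y t.
Proof.
  intros Ht. rewrite (gamma_integrand_add y 1 1 t) by lra.
  rewrite !Rpower_1 by (try apply Rdiv_lt_0_compat; lra). field.
Qed.

(* The tangent at [t = y] to [t ^ p] integrates exactly against [t^(y-1) e^(-t)],
   since [Gamma (y + 1) = y * Gamma y]. *)
Lemma is_int_gamma_tangent (y p : R) :
  0 < y ->
  is_int0oo (fun t => Rpower y p * (1 - p) * gamma_integrand y t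
                      + Rpower y p * p / y * gamma_integrand (y + 1) t)
    (Rpower y p * Gamma y).
Proof.
  intros Hy.
  replace (Rpower y p * Gamma y) with
    (Rpower y p * (1 - p) * Gamma y + Rpower y p * p / y * Gamma (y + 1))
    by (rewrite Gamma_succ by easy; field; lra).
  apply is_int0oo_lin; apply is_int_gamma; lra.
Qed.

Lemma gamma_tangent_eq (y p t : R) :
  0 < y -> 0 < t ->
  Rpower y p * (1 - p) * gamma_integrand y t
    + Rpower y p * p / y * gamma_integrand (y + 1) t
  = Rpower y p * ((1 + p * (t / y - 1)) * gamma_integrand y t).
Proof.
  intros Hy Ht. rewrite gamma_integrand_succ by easy. field. lra.
Qed.

Lemma Gamma_add_le (y x : R) :
  0 < y -> 0 <= x <= 1 -> Gamma (y + x) <= Rpower y x * Gamma y.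
Proof.
  intros Hy Hx.
  apply (is_int0oo_le (gamma_integrand (y + x)) _ _ _)
    with (2 := is_int_gamma (y + x) ltac:(lra)) (3 := is_int_gamma_tangent y x Hy).
  intros t Ht. rewrite gamma_tangent_eq, (gamma_integrand_add y x y t) by easy.
  apply Rmult_le_compat_l; [left; apply exp_pos|].
  apply Rmult_le_compat_r; [left; apply gamma_integrand_pos|].
  apply Rpower_le_tangent; [easy|]. now apply Rdiv_lt_0_compat.
Qed.

(** For [p <= 0] the function [t^p] is convex and lies above its tangent. At [y + 1] with
    [p = x - 1] this bounds [Gamma (y + x)] from below for [x <= 1], complementing
    [Gamma_add_le]. *)
Lemma Gamma_add_ge (y p : R) :
  0 < y -> p <= 0 -> 0 < y + p -> Rpower y p * Gamma y <= Gamma (y + p).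
Proof.
  intros Hy Hp Hyp.
  apply (is_int0oo_le _ (gamma_integrand (y + p)) _ _)
    with (2 := is_int_gamma_tangent y p Hy) (3 := is_int_gamma (y + p) Hyp).
  intros t Ht. rewrite gamma_tangent_eq, (gamma_integrand_add y p y t) by easy.
  apply Rmult_le_compat_l; [left; apply exp_pos|].
  apply Rmult_le_compat_r; [left; apply gamma_integrand_pos|].
  apply Rpower_ge_tangent; [easy|]. now apply Rdiv_lt_0_compat.
Qed.

Lemma Gamma_pos (x : R) : 0 < x -> 0 < Gamma x.
Proof.
  revert x. apply pos_real_ind.
  (* A positive integrand alone yields only [0 <= Gamma x] here; strictness comes from comparison
     with [Gamma 1 = 1]. *)
  - intros x Hx. assert (H := Gamma_add_ge 1 (x - 1) ltac:(lra) ltac:(lra) ltac:(lra)).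
    rewrite Gamma_1 in H. replace (1 + (x - 1)) with x in H by ring.
    assert (0 < Rpower 1 (x - 1)) by apply exp_pos. lra.
  - intros x Hx IH. rewrite Gamma_succ by easy. now apply Rmult_lt_0_compat.
Qed.

Lemma ln_Gamma_succ (x : R) : 0 < x -> ln (Gamma (x + 1)) = ln x + ln (Gamma x).
Proof. intros Hx. rewrite Gamma_succ, ln_mult; auto using Gamma_pos. Qed.

(* [ln_Gamma_gap x j] tends to 0, and its successive differences are the terms of
   the series for [ln (Gamma (x + 1))], which is therefore telescoping. *)
Definition ln_Gamma_gap (x y : R) : R := ln (Gamma (x + y)) - x * ln y - ln (Gamma y).

(** The tangents to [ln] at the two points squeeze the difference between [(a-b)/(a+j)] and
    [(a-b)/(b+j)], whatever the sign of [a - b]. *)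
Lemma is_lim_seq_ln_sub (a b : R) :
  0 < a -> 0 < b -> is_lim_seq (fun j => ln (a + INR j) - ln (b + INR j)) 0.
Proof.
  intros Ha Hb.
  apply is_lim_seq_le_le with
    (fun j => (a - b) * / (a + INR j)) (fun j => (a - b) * / (b + INR j)).
  - intros j. assert (H1 := add_INR_pos a j Ha). assert (H2 := add_INR_pos b j Hb).
    assert (H3 := ln_sub_le _ _ H1 H2). assert (H4 := ln_sub_le _ _ H2 H1).
    unfold Rdiv in *.
    replace (a + INR j - (b + INR j)) with (a - b) in H3 by ring.
    replace (b + INR j - (a + INR j)) with (- (a - b)) in H4 by ring. lra.
  - replace (Finite 0) with (Finite ((a - b) * 0)) by (f_equal; ring).
    apply is_lim_seq_mult'; [apply is_lim_seq_const|apply is_lim_seq_inv_add_INR].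
  - replace (Finite 0) with (Finite ((a - b) * 0)) by (f_equal; ring).
    apply is_lim_seq_mult'; [apply is_lim_seq_const|apply is_lim_seq_inv_add_INR].
Qed.

(** On [(0, 1]] the two tangent bounds for [Gamma (y + x)] squeeze the gap. Passing from [x] to
    [x + 1] adds [ln (x + y) - ln y], which tends to 0. *)
Lemma is_lim_seq_ln_Gamma_gap (x : R) :
  0 < x -> is_lim_seq (fun j => ln_Gamma_gap x (1 + INR j)) 0.
Proof.
  revert x. apply pos_real_ind.
  - intros x Hx.
    apply is_lim_seq_le_le with
      (fun j => (x - 1) * (ln (2 + INR j) - ln (1 + INR j))) (fun _ => 0).
    + intros j. assert (Hy := add_INR_pos 1 j Rlt_0_1).
      replace (2 + INR j) with (1 + INR j + 1) by ring. set (y := 1 + INR j) in *.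
      unfold ln_Gamma_gap. rewrite (Rplus_comm x y).
      assert (Hg := Gamma_pos y Hy). assert (Hgx := Gamma_pos (y + x) ltac:(lra)).
      split.
      * assert (H := Gamma_add_ge (y + 1) (x - 1) ltac:(lra) ltac:(lra) ltac:(lra)).
        replace (y + 1 + (x - 1)) with (y + x) in H by ring.
        assert (Hg1 := Gamma_pos (y + 1) ltac:(lra)).
        apply ln_le in H; [|apply Rmult_lt_0_compat; [apply exp_pos|easy]].
        rewrite ln_mult, ln_Gamma_succ in H by (try apply exp_pos; easy).
        unfold Rpower in H. rewrite ln_exp in H. lra.
      * assert (H := Gamma_add_le y x Hy ltac:(lra)).
        apply ln_le in H; [|easy].
        rewrite ln_mult in H by (try apply exp_pos; easy).
        unfold Rpower in H. rewrite ln_exp in H. lra.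
    + replace (Finite 0) with (Finite ((x - 1) * 0)) by (f_equal; ring).
      apply is_lim_seq_mult'; [apply is_lim_seq_const|apply is_lim_seq_ln_sub; lra].
    + apply is_lim_seq_const.
  - intros x Hx IH.
    apply is_lim_seq_ext with
      (fun j => ln_Gamma_gap x (1 + INR j) + (ln (x + 1 + INR j) - ln (1 + INR j))).
    + intros j. assert (Hy := add_INR_pos 1 j Rlt_0_1).
      unfold ln_Gamma_gap.
      replace (x + 1 + INR j) with (x + (1 + INR j)) by ring.
      replace (x + 1 + (1 + INR j)) with (x + (1 + INR j) + 1) by ring.
      rewrite ln_Gamma_succ by lra. ring.
    + replace (Finite 0) with (Finite (0 + 0)) by (f_equal; ring).
      apply is_lim_seq_plus'; [easy|apply is_lim_seq_ln_sub; lra].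
Qed.

(* Logarithm of Euler's product for [Gamma (x + 1)], with factors
   [(1 + 1 / m) ^ x / (1 + x / m)] where [m = j + 1]. *)
Definition ln_Gamma_term (j : nat) (x : R) : R :=
  x * (ln (1 + INR (S j)) - ln (1 + INR j)) - (ln (x + (1 + INR j)) - ln (1 + INR j)).

Lemma is_series_ln_Gamma (x : R) :
  0 < x -> is_series (fun j => ln_Gamma_term j x) (ln (Gamma (x + 1))).
Proof.
  intros Hx.
  assert (H := is_series_telescope _ _ (is_lim_seq_ln_Gamma_gap x Hx)).
  cbv beta in H.
  replace (ln_Gamma_gap x (1 + INR 0) - 0) with (ln (Gamma (x + 1))) in H.
  - refine (is_series_ext _ _ _ _ H). intros j.
    assert (Hy := add_INR_pos 1 j Rlt_0_1).
    unfold ln_Gamma_gap, ln_Gamma_term. rewrite S_INR.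
    replace (x + (1 + (INR j + 1))) with (x + (1 + INR j) + 1) by ring.
    replace (1 + (INR j + 1)) with (1 + INR j + 1) by ring.
    rewrite !ln_Gamma_succ by lra.
    match goal with |- ?u = ?v => change (@eq R u v) end. ring.
  - unfold ln_Gamma_gap. simpl INR. rewrite Rplus_0_r, Gamma_1, ln_1. ring.
Qed.

(** * Termwise differentiation of series *)

(** Two applications of the mean value theorem write the remainder as [h (c - x) f2 d] with
    [|c - x| <= |h|], for either sign of [h]. *)
Lemma Rabs_taylor1_le (F f f2 : R -> R) (a b x h M : R) :
  a < x < b -> a < x + h < b ->
  (forall y, a < y < b -> is_derive F y (f y)) ->
  (forall y, a < y < b -> is_derive f y (f2 y)) ->
  (forall y, a < y < b -> Rabs (f2 y) <= M) ->
  Rabs (F (x + h) - F x - h * f x) <= M * (h * h).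
Proof.
  intros Hx Hxh HF Hf HM.
  assert (Hbt : forall y u v, a < u < b -> a < v < b -> Rmin u v <= y <= Rmax u v -> a < y < b).
  { intros y u v Hu Hv Hy. unfold Rmin, Rmax in Hy. destruct (Rle_dec u v); lra. }
  destruct (MVT_gen F x (x + h) f) as [c [Hc Ec]].
  - intros y Hy. apply HF, (Hbt y x (x + h)); lra.
  - intros y Hy. apply derivable_continuous_pt. exists (f y).
    apply is_derive_Reals, HF, (Hbt y x (x + h)); lra.
  - assert (Hcb := Hbt c x (x + h) Hx Hxh Hc).
    destruct (MVT_gen f x c f2) as [d [Hd Ed]].
    + intros y Hy. apply Hf, (Hbt y x c); lra.
    + intros y Hy. apply derivable_continuous_pt. exists (f2 y).
      apply is_derive_Reals, Hf, (Hbt y x c); lra.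
    + assert (Hdb := Hbt d x c Hx Hcb Hd).
      replace (F (x + h) - F x - h * f x) with (f2 d * ((c - x) * h)).
      * rewrite Rabs_mult. apply Rmult_le_compat; try apply Rabs_pos; [now apply HM|].
        rewrite Rabs_mult.
        assert (Hch : Rabs (c - x) <= Rabs h).
        { unfold Rmin, Rmax in Hc. destruct (Rle_dec x (x + h)).
          - rewrite !Rabs_pos_eq; lra.
          - rewrite !Rabs_left1; lra. }
        replace (h * h) with (Rabs h * Rabs h)
          by (rewrite <- Rabs_mult; apply Rabs_pos_eq, Rle_0_sqr).
        apply Rmult_le_compat_r; [apply Rabs_pos|easy].
      * rewrite <- Rmult_assoc, <- Ed.
        replace (x + h - x) with h in Ec by ring. rewrite Ec. ring.
Qed.

(** A summable bound on the second derivatives lets the first-order Taylor remainders be summed: the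
    remainder of the whole series is at most [Series M * h^2], so the difference quotient is off by
    at most [Series M * |h|]. *)
Lemma is_derive_Series (F f f2 : nat -> R -> R) (M : nat -> R) (a b x : R) :
  a < x < b ->
  (forall j y, a < y < b -> is_derive (F j) y (f j y)) ->
  (forall j y, a < y < b -> is_derive (f j) y (f2 j y)) ->
  (forall j y, a < y < b -> Rabs (f2 j y) <= M j) ->
  ex_series M ->
  (forall y, a < y < b -> ex_series (fun j => F j y)) ->
  ex_series (fun j => f j x) ->
  is_derive (fun y => Series (fun j => F j y)) x (Series (fun j => f j x)).
Proof.
  intros Hx HF Hf HM Hex HexF Hexf.
  assert (HT : forall h, a < x + h < b ->
    Rabs (Series (fun j => F j (x + h)) - Series (fun j => F j x)
          - h * Series (fun j => f j x)) <= Series M * (h * h)).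
  { intros h Hh.
    rewrite <- Series_minus, <- Series_scal_l, <- Series_minus, <- Series_scal_r.
    - assert (Ht : forall j, Rabs (F j (x + h) - F j x - h * f j x) <= M j * (h * h))
        by (intros j; apply (Rabs_taylor1_le (F j) (f j) (f2 j) a b); auto).
      assert (HexM : ex_series (fun j => M j * (h * h)))
        by now apply (ex_series_scal_r (h * h)).
      eapply Rle_trans; [apply Series_Rabs|apply Series_le; [|easy]].
      + apply (@ex_series_le R_AbsRing R_CompleteNormedModule) with (2 := HexM).
        intros j. change norm with Rabs. rewrite Rabs_Rabsolu. apply Ht.
      + intros j. split; [apply Rabs_pos|apply Ht].
    - apply (ex_series_minus (V := R_NormedModule)); auto.
    - now apply (ex_series_scal (V := R_NormedModule)).
    - auto.
    - auto. }
  assert (HM0 : 0 <= Series M).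
  { replace 0 with (Series (fun _ : nat => 0 * 0)) by (rewrite Series_scal_l; ring).
    apply Series_le; [|easy]. intros j. rewrite Rmult_0_l. split; [lra|].
    apply Rle_trans with (2 := HM j x Hx), Rabs_pos. }
  apply is_derive_Reals. intros eps Heps.
  set (C := Series M) in *.
  (* The first two terms keep [x + h] inside [(a, b)]. Dividing by [C + 1] rather than [C] allows
     [C = 0]. *)
  assert (Hd : 0 < Rmin (Rmin (x - a) (b - x)) (eps / (C + 1))).
  { repeat apply Rmin_pos; [lra|lra|]. apply Rdiv_lt_0_compat; lra. }
  exists (mkposreal _ Hd). simpl. intros h Hh0 Hh.
  apply Rmin_Rgt in Hh. destruct Hh as [Hh1 Hh2].
  apply Rmin_Rgt in Hh1. destruct Hh1 as [Hh1 Hh3].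
  assert (Hab := Rabs_def2 _ _ Hh1). assert (Hab' := Rabs_def2 _ _ Hh3).
  specialize (HT h ltac:(lra)).
  set (D := Series (fun j => F j (x + h)) - Series (fun j => F j x)) in *.
  set (l := Series (fun j => f j x)) in *.
  replace (D / h - l) with ((D - h * l) / h) by (field; easy).
  unfold Rdiv. rewrite Rabs_mult, Rabs_inv.
  assert (Hhp := Rabs_pos_lt h Hh0).
  apply Rle_lt_trans with (C * Rabs h).
  - apply Rle_div_l; [easy|]. rewrite Rmult_assoc, <- Rabs_mult.
    rewrite (Rabs_pos_eq (h * h)) by apply Rle_0_sqr. easy.
  - apply Rgt_lt in Hh2. apply Rlt_div_r in Hh2; [|lra]. lra.
Qed.

Lemma is_derive_inv_pow (c y : R) (m : nat) :
  0 < y + c ->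
  is_derive (fun y => / (y + c) ^ m) y (- INR m * / (y + c) ^ S m).
Proof.
  intros H. assert (0 < (y + c) ^ m) by now apply pow_lt.
  auto_derive; [lra|]. destruct m as [|m].
  - simpl. field. lra.
  - rewrite Nat.pred_succ. simpl pow in *.
    assert (0 < (y + c) ^ m) by now apply pow_lt. field. lra.
Qed.

Lemma is_derive_hurwitz (m : nat) (x : R) :
  (2 <= m)%nat -> 0 < x ->
  is_derive (hurwitz m) x (- INR m * hurwitz (S m) x).
Proof.
  intros Hm Hx. unfold hurwitz. rewrite <- Series_scal_l.
  (* Keeping [y] above [x/2] bounds the second derivatives by their values at [x/2], which are
     summable. *)
  apply (is_derive_Series (fun j y => / (y + INR j) ^ m)
    (fun j y => - INR m * / (y + INR j) ^ S m)
    (fun j y => - INR m * (- INR (S m) * / (y + INR j) ^ S (S m)))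
    (fun j => INR m * INR (S m) * / (x / 2 + INR j) ^ S (S m)) (x / 2) (x + 1)).
  - lra.
  - intros j y Hy. apply is_derive_inv_pow, add_INR_pos; lra.
  - intros j y Hy. apply is_derive_scal.
    apply is_derive_inv_pow, add_INR_pos; lra.
  - intros j y Hy.
    assert (H1 := add_INR_pos y j ltac:(lra)). assert (H2 := add_INR_pos (x / 2) j ltac:(lra)).
    assert (H3 := pow_lt _ (S (S m)) H1). assert (H4 := pow_lt _ (S (S m)) H2).
    assert (H5 : 0 <= INR m * INR (S m)) by (apply Rmult_le_pos; apply pos_INR).
    replace (- INR m * (- INR (S m) * / (y + INR j) ^ S (S m)))
      with (INR m * INR (S m) * / (y + INR j) ^ S (S m)) by ring.
    rewrite Rabs_pos_eq by (apply Rmult_le_pos; [easy|left; now apply Rinv_0_lt_compat]).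
    apply Rmult_le_compat_l; [easy|].
    apply Rinv_le_contravar; [easy|]. apply pow_incr; lra.
  - apply (ex_series_scal (V := R_NormedModule)), ex_series_hurwitz; [lia|lra].
  - intros y Hy. apply ex_series_hurwitz; [lia|lra].
  - apply (ex_series_scal (V := R_NormedModule)), ex_series_hurwitz; [lia|lra].
Qed.

(** * The series for psi and its derivatives *)

(** The derivative of [ln_Gamma_term j]; these are the terms of the series for [psi (x + 1)]. *)
Definition digamma_term (j : nat) (x : R) : R :=
  (ln (1 + INR (S j)) - ln (1 + INR j)) - / (x + (1 + INR j)).

(** With [v = 1 + j], the logarithmic increment lies between [1/(v+1)] and [1/v], so it differs from
    [1/(x+v)] by at most [(x+1)/v^2]. *)
Lemma ex_series_digamma_term (x : R) : 0 < x -> ex_series (fun j => digamma_term j x).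
Proof.
  intros Hx.
  apply (@ex_series_le R_AbsRing R_CompleteNormedModule) with
    (fun j => (x + 1) * / (1 + INR j) ^ 2).
  - intros j. change norm with Rabs. unfold digamma_term.
    assert (Hv := add_INR_pos 1 j Rlt_0_1). rewrite S_INR.
    replace (1 + (INR j + 1)) with (1 + INR j + 1) by ring.
    set (v := 1 + INR j) in *. assert (Hv1 : 1 <= v) by (assert (H := pos_INR j); unfold v; lra).
    assert (H1 := ln_sub_le (v + 1) v ltac:(lra) Hv).
    assert (H2 := ln_sub_le v (v + 1) Hv ltac:(lra)).
    replace ((v + 1 - v) / v) with (/ v) in H1 by (field; lra).
    replace ((v - (v + 1)) / (v + 1)) with (- / (v + 1)) in H2 by (field; lra).
    assert (Hd : 0 < v ^ 2 * (x + v)) by (apply Rmult_lt_0_compat; [apply pow_lt|]; lra).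
    apply Rabs_le. split.
    + assert (0 <= (/ (v + 1) - / (x + v)) + (x + 1) * / v ^ 2); [|lra].
      replace ((/ (v + 1) - / (x + v)) + (x + 1) * / v ^ 2) with
        (((x - 1) * v ^ 2 + (x + 1) * (v + 1) * (x + v)) / ((v + 1) * (v ^ 2 * (x + v))))
        by (field; lra).
      apply Rdiv_le_0_compat; [nra|apply Rmult_lt_0_compat; lra].
    + assert (0 <= (x + 1) * / v ^ 2 - (/ v - / (x + v))); [|lra].
      replace ((x + 1) * / v ^ 2 - (/ v - / (x + v))) with
        ((x * x + x + v) / (v ^ 2 * (x + v))) by (field; lra).
      apply Rdiv_le_0_compat; [nra|easy].
  - apply (ex_series_scal (V := R_NormedModule)), ex_series_hurwitz; [lia|lra].
Qed.

Lemma is_derive_digamma_term (j : nat) (y : R) :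
  0 < y -> is_derive (digamma_term j) y (/ (y + (1 + INR j)) ^ 2).
Proof.
  intros Hy. assert (Hj := add_INR_pos 1 j Rlt_0_1).
  unfold digamma_term. set (c := 1 + INR j) in *. auto_derive; [lra|]. field. lra.
Qed.

Lemma is_derive_ln_Gamma_succ (x : R) :
  0 < x ->
  is_derive (fun y => ln (Gamma (y + 1))) x (Series (fun j => digamma_term j x)).
Proof.
  intros Hx.
  apply is_derive_ext_loc with (fun y => Series (fun j => ln_Gamma_term j y)).
  { apply (filter_imp (fun y => 0 < y)); [|now apply locally_pos].
    intros y Hy. now apply is_series_unique, is_series_ln_Gamma. }
  (* The left endpoint 0 is admissible: the denominators are [y + (1 + j)], so the second
     derivatives stay below [1/(1+j)^2]. *)
  apply (is_derive_Series ln_Gamma_term digamma_term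
    (fun j y => / (y + (1 + INR j)) ^ 2) (fun j => / (1 + INR j) ^ 2) 0 (x + 1)).
  - lra.
  - intros j y Hy. assert (Hj := add_INR_pos 1 j Rlt_0_1).
    unfold ln_Gamma_term, digamma_term. set (c := 1 + INR j) in *. set (d := 1 + INR (S j)).
    auto_derive; [lra|]. field. lra.
  - intros j y Hy. apply is_derive_digamma_term; lra.
  - intros j y Hy. assert (Hj := add_INR_pos 1 j Rlt_0_1).
    rewrite Rabs_pos_eq by (left; apply Rinv_0_lt_compat, pow_lt; lra).
    apply Rinv_le_contravar; [now apply pow_lt|]. apply pow_incr; lra.
  - apply ex_series_hurwitz; [lia|lra].
  - intros y Hy. eexists. apply is_series_ln_Gamma; lra.
  - now apply ex_series_digamma_term.
Qed.

(** Differentiability of [Gamma] is read off from [Gamma y = exp (ln (Gamma (y + 1)) - ln y)], which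
    avoids differentiation under the integral sign. The shift by 1 contributes [-1/x]. *)
Lemma psi_eq (x : R) : 0 < x -> psi x = - / x + Series (fun j => digamma_term j x).
Proof.
  intros Hx. unfold psi.
  assert (HG : is_derive Gamma x
    (Gamma x * (- / x + Series (fun j => digamma_term j x)))).
  { apply is_derive_ext_loc with (fun y => exp (ln (Gamma (y + 1)) - ln y)).
    - apply (filter_imp (fun y => 0 < y)); [|now apply locally_pos].
      intros y Hy. rewrite ln_Gamma_succ by easy.
      replace (ln y + ln (Gamma y) - ln y) with (ln (Gamma y)) by ring.
      apply exp_ln. now apply Gamma_pos.
    - replace (Gamma x) with (exp (ln (Gamma (x + 1)) - ln x)).
      + rewrite Rmult_comm. apply (is_derive_comp exp (fun y => ln (Gamma (y + 1)) - ln y)).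
        * auto_derive; [easy|]. ring.
        * rewrite Rplus_comm. apply (is_derive_minus (V := R_NormedModule)).
          -- now apply is_derive_ln_Gamma_succ.
          -- auto_derive; [easy|]. field. lra.
      + rewrite ln_Gamma_succ by easy.
        replace (ln x + ln (Gamma x) - ln x) with (ln (Gamma x)) by ring.
        apply exp_ln. now apply Gamma_pos. }
  assert (H := Gamma_pos x Hx).
  rewrite (is_derive_unique _ _ _ HG). field. split; lra.
Qed.

Lemma is_derive_psi (x : R) : 0 < x -> is_derive psi x (hurwitz 2 x).
Proof.
  intros Hx.
  apply is_derive_ext_loc with (fun y => - / y + Series (fun j => digamma_term j y)).
  { apply (filter_imp (fun y => 0 < y)); [|now apply locally_pos].
    intros y Hy. symmetry. now apply psi_eq. }
  (* The term of index 0 is the derivative of [-1/x]; the others come from the digamma terms. *)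
  unfold hurwitz. rewrite Series_incr_1 by (apply ex_series_hurwitz; [lia|easy]).
  apply (is_derive_plus (V := R_NormedModule)).
  - simpl INR. rewrite Rplus_0_r. auto_derive; [lra|]. field. lra.
  - rewrite (Series_ext _ (fun j => / (x + (1 + INR j)) ^ 2))
      by (intros; rewrite S_INR; f_equal; f_equal; ring).
    apply (is_derive_Series digamma_term (fun j y => / (y + (1 + INR j)) ^ 2)
      (fun j y => - INR 2 * / (y + (1 + INR j)) ^ 3)
      (fun j => 2 * / (1 + INR j) ^ 3) 0 (x + 1)).
    + lra.
    + intros j y Hy. apply is_derive_digamma_term; lra.
    + intros j y Hy. assert (Hj := add_INR_pos 1 j Rlt_0_1).
      apply (is_derive_inv_pow (1 + INR j) y 2). lra.
    + intros j y Hy. assert (Hj := add_INR_pos 1 j Rlt_0_1).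
      assert (H := pow_lt (y + (1 + INR j)) 3 ltac:(lra)).
      replace (- INR 2 * / (y + (1 + INR j)) ^ 3) with (- (2 * / (y + (1 + INR j)) ^ 3))
        by (simpl INR; ring).
      rewrite Rabs_Ropp, Rabs_pos_eq
        by (apply Rmult_le_pos; [lra|left; now apply Rinv_0_lt_compat]).
      apply Rmult_le_compat_l; [lra|].
      apply Rinv_le_contravar; [now apply pow_lt|]. apply pow_incr; lra.
    + apply (ex_series_scal (V := R_NormedModule)), ex_series_hurwitz; [lia|lra].
    + intros y Hy. apply ex_series_digamma_term; lra.
    + apply (ex_series_ext (fun j => / (x + 1 + INR j) ^ 2)).
      * intros j. f_equal. f_equal. ring.
      * apply ex_series_hurwitz; [lia|lra].
Qed.

Lemma polygamma_eq (n : nat) (x : R) :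
  0 < x ->
  polygamma (S n) x = (-1) ^ n * INR (Factorial.fact (S n)) * hurwitz (S (S n)) x.
Proof.
  unfold polygamma. revert x. induction n as [|n IH]; intros x Hx.
  - change (Derive_n psi 1 x) with (Derive psi x). rewrite (is_derive_unique _ _ _ (is_derive_psi x Hx)).
    change (INR (Factorial.fact 1)) with 1. simpl pow. ring.
  - change (Derive_n psi (S (S n)) x) with (Derive (Derive_n psi (S n)) x).
    rewrite (Derive_ext_loc _
      (fun y => (-1) ^ n * INR (Factorial.fact (S n)) * hurwitz (S (S n)) y)).
    + rewrite Derive_scal.
      rewrite (is_derive_unique _ _ _ (is_derive_hurwitz (S (S n)) x ltac:(lia) Hx)).
      rewrite (fact_simpl (S n)), mult_INR. rewrite <- tech_pow_Rmult. ring.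
    + apply (filter_imp (fun y => 0 < y)); [exact IH|now apply locally_pos].
Qed.

Lemma hurwitz_pos (m : nat) (x : R) : (2 <= m)%nat -> 0 < x -> 0 < hurwitz m x.
Proof.
  intros Hm Hx. destruct m as [|m]; [lia|].
  assert (H := hurwitz_gt_inv_pow m x ltac:(lia) Hx).
  assert (H1 : 0 < (/ x) ^ m) by now apply pow_lt, Rinv_0_lt_compat.
  assert (H2 : 0 < INR m) by (apply lt_0_INR; lia). nra.
Qed.

(** * Comparison of the roots *)

(** The absolute value removes the sign [(-1)^(n-1)], and [n! / (n-1)! = n]. *)
Lemma root_term_eq (n : nat) (x : R) :
  (1 <= n)%nat -> 0 < x ->
  root_term n x = Rpower (INR n * hurwitz (S n) x) (/ INR n).
Proof.
  intros Hn Hx. unfold root_term. destruct n as [|n]; [lia|].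
  f_equal. rewrite polygamma_eq by easy.
  replace (S n - 1)%nat with n by lia.
  assert (Hh := hurwitz_pos (S (S n)) x ltac:(lia) Hx).
  assert (Hf := INR_fact_lt_0 n).
  rewrite !Rabs_mult, pow_1_abs, Rmult_1_l, (Rabs_pos_eq (INR _)), (Rabs_pos_eq (hurwitz _ _))
    by (try apply pos_INR; lra).
  rewrite fact_simpl, mult_INR. field. lra.
Qed.

Lemma Rpower_pow_inv (c : R) (n : nat) :
  (1 <= n)%nat -> 0 < c -> Rpower (c ^ n) (/ INR n) = c.
Proof.
  intros Hn Hc. rewrite <- Rpower_pow, Rpower_mult by easy.
  rewrite Rinv_r by (apply not_0_INR; lia). now apply Rpower_1.
Qed.

Lemma root_term_gt (n : nat) (x c : R) :
  (1 <= n)%nat -> 0 < x -> 0 < c -> c ^ n < INR n * hurwitz (S n) x -> c < root_term n x.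
Proof.
  intros Hn Hx Hc H. rewrite root_term_eq, <- (Rpower_pow_inv c n) by easy.
  apply Rlt_Rpower_l.
  - apply Rinv_0_lt_compat, lt_0_INR; lia.
  - split; [now apply pow_lt|easy].
Qed.

Lemma root_term_le (k : nat) (x c : R) :
  (1 <= k)%nat -> 0 < x -> 0 < c -> INR k * hurwitz (S k) x <= c ^ k -> root_term k x <= c.
Proof.
  intros Hk Hx Hc H. rewrite root_term_eq, <- (Rpower_pow_inv c k) by easy.
  assert (HI : 0 < INR k) by (apply lt_0_INR; lia).
  apply Rle_Rpower_l.
  - left; now apply Rinv_0_lt_compat.
  - split; [|easy]. apply Rmult_lt_0_compat; [easy|]. apply hurwitz_pos; [lia|easy].
Qed.

(** The tangent bound [ln (x+j+1) - ln (x+j) >= 1/(x+j+1)] compares the digamma terms with the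
    telescoping [ln (x+j) - ln (1+j)], which starts at [ln x]. *)
Lemma psi_ge (x : R) : 0 < x -> ln x - / x <= psi x.
Proof.
  intros Hx. rewrite psi_eq by easy.
  assert (H : ln (x + INR 0) - ln (1 + INR 0) <= Series (fun j => digamma_term j x)).
  { apply (Series_ge_telescope _ (fun j => ln (x + INR j) - ln (1 + INR j))).
    - apply is_lim_seq_ln_sub; lra.
    - intros j. unfold digamma_term. assert (Hj := add_INR_pos x j Hx).
      assert (H := ln_sub_le (x + INR j) (x + (1 + INR j)) ltac:(lra) ltac:(lra)).
      replace ((x + INR j - (x + (1 + INR j))) / (x + (1 + INR j)))
        with (- / (x + (1 + INR j))) in H by (field; lra).
      replace (x + INR (S j)) with (x + (1 + INR j)) by (rewrite S_INR; ring).
      lra.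
    - now apply ex_series_digamma_term. }
  simpl INR in H. rewrite !Rplus_0_r, ln_1 in H. lra.
Qed.

Lemma exp_opp_psi_sqr_le (x : R) :
  0 < x -> (exp (- psi (/ ln (1 + / x)))) ^ 2 <= (x + 1) / x ^ 3.
Proof.
  intros Hx. assert (Hix := Rinv_0_lt_compat x Hx).
  set (s := ln (1 + / x)).
  assert (Hs : 0 < s) by (unfold s; rewrite <- ln_1; apply ln_increasing; lra).
  assert (Hes : exp s = 1 + / x) by (apply exp_ln; lra).
  assert (Hpsi := psi_ge (/ s) (Rinv_0_lt_compat _ Hs)).
  rewrite ln_Rinv, Rinv_inv in Hpsi by easy.
  assert (HE : exp (- psi (/ s)) <= s * exp s).
  { rewrite <- (exp_ln s Hs) at 2. rewrite <- exp_plus. apply exp_le_mono. lra. }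
  assert (Hh := mul_exp_half_le s (Rlt_le _ _ Hs)).
  assert (Hp := exp_pos (- psi (/ s))).
  apply Rle_trans with ((s * exp s) ^ 2); [apply pow_incr; lra|].
  (* Splitting [e^(2s)] as [(e^(s/2))^2 e^s] lets [s e^(s/2) <= e^s - 1 = 1/x] be used under the
     square, and leaves the factor [e^s = 1 + 1/x]. *)
  replace ((s * exp s) ^ 2) with ((s * exp (s / 2)) ^ 2 * exp s).
  - replace ((x + 1) / x ^ 3) with ((/ x) ^ 2 * (1 + / x)) by (field; lra).
    rewrite Hes in *. apply Rmult_le_compat_r; [lra|].
    apply pow_incr. split; [|lra].
    apply Rmult_le_pos; [lra|left; apply exp_pos].
  - replace (exp s) with (exp (s / 2) * exp (s / 2)) by (rewrite <- exp_plus; f_equal; field).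
    ring.
Qed.

Theorem theorem1p1 :
  (forall (n : nat) (x : R), (n = 1 \/ n = 2)%nat -> 0 < x ->
     root_term n x > exp (- psi (/ ln (1 + / x)))) /\
  (forall (n k : nat) (x : R), (1 <= k)%nat -> (k <= n - 1)%nat -> 0 < x ->
     root_term n x > root_term k (/ ln (1 + / x))).
Proof.
  split.
  - intros n x Hn Hx. assert (Hsq := exp_opp_psi_sqr_le x Hx).
    assert (HE := exp_pos (- psi (/ ln (1 + / x)))).
    set (E := exp (- psi (/ ln (1 + / x)))) in *.
    destruct Hn as [->| ->]; apply root_term_gt; try easy; try lia.
    + assert (H := hurwitz2_gt x Hx). simpl INR. rewrite pow_1, Rmult_1_l.
      apply Rle_lt_trans with (2 := H).
      (* For [n = 1] the comparison is made between squares: that of [1/x + 1/(2x^2)] exceeds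
         [(x+1)/x^3] by [1/(4x^4)]. *)
      apply Rnot_lt_le. intros Hlt.
      assert (Hb : 0 <= / x + / (2 * x ^ 2)).
      { assert (0 < / x) by now apply Rinv_0_lt_compat.
        assert (0 < / (2 * x ^ 2)); [|lra].
        apply Rinv_0_lt_compat. assert (0 < x ^ 2) by now apply pow_lt. lra. }
      assert (H2 : (/ x + / (2 * x ^ 2)) ^ 2 <= E ^ 2) by (apply pow_incr; lra).
      replace ((/ x + / (2 * x ^ 2)) ^ 2) with ((x + 1) / x ^ 3 + / (4 * x ^ 4)) in H2
        by (field; lra).
      assert (0 < / (4 * x ^ 4)); [|lra].
      apply Rinv_0_lt_compat. assert (0 < x ^ 4) by now apply pow_lt. lra.
    + assert (H := hurwitz3_gt x Hx). simpl INR. lra.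
  - intros n k x Hk Hkn Hx.
    assert (Hix := Rinv_0_lt_compat x Hx).
    assert (Hs : 0 < ln (1 + / x)) by (rewrite <- ln_1; apply ln_increasing; lra).
    apply Rle_lt_trans with (/ x).
    + apply root_term_le; [easy|now apply Rinv_0_lt_compat|easy|].
      replace (/ x) with (exp (/ / ln (1 + / x)) - 1) at 2.
      * apply hurwitz_le_exp_inv; [easy|now apply Rinv_0_lt_compat].
      * rewrite Rinv_inv, exp_ln by lra. ring.
    + apply root_term_gt; [lia|easy|easy|]. apply hurwitz_gt_inv_pow; [lia|easy].
Qed.
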